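(* Let $\rho$ be a left-continuous convex modular on a real vector space $X$. Let $\tau_*$ be the collection of all subsets $A\subset X_\rho$ with the following property: for every $x\in A$ there exist $\lambda>0$ and $\varepsilon>0$, both possibly depending on $x$, such that $B_{\rho_\lambda,\varepsilon}(x)\subseteq A$. Then the following hold: (i) $\tau_*$ is a topology on $X_\rho$ and $\tau_\lambda\subseteq\tau_*$ for every $\lambda>0$. Consequently, since $\tau^i$ is the weakest topology stronger than every $\tau_\lambda$, $\tau^i\subseteq\tau_*$. (ii) For any sequence $(x_k)\subset X_\rho$ and $x\in X_\rho$, $x_k\to x$ in $\tau_*$ if and only if $\rho_\lambda(x_k-x)\to0$ for every $\lambda>0$. Consequently, $\tau^i$ and $\tau_*$ have the same convergent sequences (but they are not necessarily equal). (iii) Let $\tau_{\|\cdot\|_\rho}$ denote the topology induced on $X_\rho$ by the Luxemburg norm. Then $\tau_{\|\cdot\|_\rho}=\tau_*$. Moreover, $\tau_{\|\cdot\|_\rho}$ is the weakest first-countable topology that is stronger than every $\tau_\lambda$, $\lambda>0$.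
   Context: A (convex) modular on a real vector space $X$ is a functional $\rho:X\to[0,\infty]$ such that (1) $\rho(u)=0$ iff $u=0$; (2) $\rho(\alpha u)=\rho(u)$ if $|\alpha|=1$; (3) $\rho(\alpha u+(1-\alpha)v)\le\alpha\rho(u)+(1-\alpha)\rho(v)$ for all $\alpha\in[0,1]$, $u,v\in X$. It is left-continuous if $\lim_{\lambda\to\lambda_0^-}\rho(\lambda u)=\rho(\lambda_0u)$ for every $u\in X$ and $\lambda_0>0$. The modular space is the vector subspace $X_\rho=\{v\in X:\rho(\lambda v)<\infty\text{ for some }\lambda>0\}$. The Luxemburg norm on $X_\rho$ is $\|x\|_\rho=\inf\{\lambda>0:\rho(\lambda^{-1}x)\le1\}$. For $\lambda>0$ put $\rho_\lambda(x)=\rho(\lambda x)$; this is again a convex modular with $X_{\rho_\lambda}=X_\rho$. For $x\in X_\rho$ and $\varepsilon>0$, $B_{\rho_\lambda,\varepsilon}(x)=\{y:\rho_\lambda(y-x)<\varepsilon\}\subseteq X_\rho$. The topology $\tau_\lambda$ on $X_\rho$ is the modular topology of $\rho_\lambda$: $A\subseteq X_\rho$ is $\tau_\lambda$-open iff for every $x\in A$ there is $\varepsilon>0$ with $B_{\rho_\lambda,\varepsilon}(x)\subset A$. The initial topology $\tau^i$ is the weakest topology on $X_\rho$ that contains $\tau_\lambda$ for every $\lambda>0$. ''Stronger'' and ''weaker'' are meant in the non-strict sense. *)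

(* Defs.v *)
From HB Require Import structures.
From mathcomp Require Import all_boot all_order all_algebra.
From mathcomp Require Import all_classical all_reals all_analysis.
Import Order.TTheory GRing.Theory Num.Theory.
Import numFieldNormedType.Exports.

Set Implicit Arguments.
Unset Strict Implicit.
Unset Printing Implicit Defensive.

Local Open Scope classical_set_scope.
Local Open Scope ring_scope.

(** Several topologies on one carrier have to be compared, so a topology is
    represented by its collection of open sets, and inclusion is the (non-strict)
    "weaker than" order. *)
Section Topologies.
Variable T : Type.
Implicit Types tau : set (set T).

Definition is_topology tau : Prop :=
  [/\ tau set0,
      tau setT,
      forall A B, tau A -> tau B -> tau (A `&` B)
    & forall F : set (set T), F `<=` tau -> tau (\bigcup_(A in F) A)].

Definition converges_in tau (u : nat -> T) (x : T) : Prop :=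
  cvg_to (u @ \oo) (nbhs_of_open tau x).

(** The local bases are indexed by [nat], with repetitions allowed; a local base
    is never empty, so this is the same as asking for a countable one. *)
Definition is_first_countable tau : Prop :=
  forall x, exists2 B : nat -> set T,
    (forall n, nbhs_of_open tau x (B n)) &
    (forall A, nbhs_of_open tau x A -> exists n, B n `<=` A).

Definition is_weakest (C : set (set (set T))) tau : Prop :=
  C tau /\ forall tau', C tau' -> tau `<=` tau'.

End Topologies.

Section Modulars.
Variables (R : realType) (X : lmodType R).
Implicit Types (rho : X -> \bar R) (l e a : R).

(** In the convexity inequality [0 * +oo = 0], as everywhere in [\bar R]. *)
Record is_convex_modular rho : Prop := {
  modular_ge0 : forall u, (0 <= rho u)%E;
  modular_eq0 : forall u, rho u = 0%E <-> u = 0;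
  modular_unit : forall a u, `|a| = 1 -> rho (a *: u) = rho u;
  modular_convex : forall a (u v : X), 0 <= a <= 1 ->
    (rho (a *: u + (1 - a) *: v)%R
       <= a%:E * rho u + (1 - a)%:E * rho v)%E }.

Definition left_continuous rho : Prop :=
  forall (u : X) l0, 0 < l0 ->
    rho (l *: u) @[l --> l0^'-] --> rho (l0 *: u).

Definition modular_space rho : set X :=
  [set v | exists2 l, 0 < l & (rho (l *: v) < +oo)%E].

Definition scaled rho l : X -> \bar R := fun x => rho (l *: x).

(** Used for [x] in [modular_space rho] only: elsewhere the infimum is that of
    the empty set, which is [0] by convention. *)
Definition luxemburg rho (x : X) : R :=
  inf [set l | 0 < l /\ (rho (l^-1 *: x) <= 1)%E].

Section OnModularSpace.
Variable rho : X -> \bar R.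

(** The type of the elements of the set [modular_space rho]. *)
Local Notation Xrho := (set_type (modular_space rho)).

(** For [x] in the modular space every [y : X] with [rho (l *: (y - x)) < e] is
    in the modular space as well, so no point is lost by taking [y : Xrho]. *)
Definition modular_ball l e (x : Xrho) : set Xrho :=
  [set y | (scaled rho l (\val y - \val x)%R < e%:E)%E].

Definition tau_scaled l : set (set Xrho) :=
  [set A | forall x, A x -> exists2 e, 0 < e & modular_ball l e x `<=` A].

Definition finer_than_scaled (tau : set (set Xrho)) : Prop :=
  forall l, 0 < l -> tau_scaled l `<=` tau.

Definition tau_init : set (set Xrho) :=
  smallest (@is_topology Xrho) (\bigcup_(l in [set l | 0 < l]) tau_scaled l).

Definition tau_star : set (set Xrho) :=
  [set A | forall x, A x ->
     exists l e, [/\ 0 < l, 0 < e & modular_ball l e x `<=` A]].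

Definition tau_norm : set (set Xrho) :=
  [set A | forall x, A x -> exists2 r, 0 < r &
     [set y : Xrho | luxemburg rho (\val y - \val x) < r] `<=` A].

Lemma tau_init_weakest :
  is_weakest [set tau | is_topology tau /\ finer_than_scaled tau] tau_init.
Proof.
split; last first.
  move=> tau [ttau ftau] A; apply; split=> //.
  by move=> B [l l0]; apply: ftau.
split; last by move=> l l0 A Al tau [_]; apply; exists l.
split.
- by move=> tau [[]].
- by move=> tau [[]].
- move=> A B tA tB tau Ctau; have [[_ _ tI _] _] := Ctau.
  by apply: tI; [exact: tA|exact: tB].
- move=> F Ft tau Ctau; have [[_ _ _ tU] _] := Ctau.
  by apply: tU => A /Ft; apply.
Qed.

End OnModularSpace.
End Modulars.

Arguments modular_ball {R X} rho l e x.
Arguments tau_scaled {R X} rho l.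
Arguments tau_init {R X} rho.
Arguments tau_star {R X} rho.
Arguments tau_norm {R X} rho.

(* Main.v *)
(** The balls of the Luxemburg norm are the gauge balls
    [{y | rho ((y - x) / t) <= 1 for some t < r}]. By convexity each of them contains,
    and is contained in, some [modular_ball l e x], so [tau_norm = tau_star].
    If [u] converges to [x] in [tau_scaled l], then [rho (l (u_k - x)) -> 0]:
    a limit for [rho_l] is unique, so the terms that stay away from [x] could
    otherwise be thinned out to a [tau_scaled l]-closed set missing [x]. Hence any
    topology finer than all the [tau_scaled l] has no more convergent sequences
    than [tau_star], and if it is first countable it is finer than [tau_star].

    The topologies [tau_init] and [tau_star] differ on the bounded sequences for
    the modular that is [sup_n |x_n| / (n + 1)] on the unit ball of the sup norm and
    [+oo] elsewhere. Its Luxemburg norm is the sup norm, but adding a far enough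
    tail [1/l, 1/l, ...] again and again never leaves a [tau_scaled l]-open set. *)
Require Import Defs.
From HB Require Import structures.
From mathcomp Require Import all_boot all_order all_algebra.
From mathcomp Require Import all_classical all_reals all_analysis.
From mathcomp Require Import ring lra.
Import Order.TTheory GRing.Theory Num.Theory.
Import numFieldNormedType.Exports.

Local Open Scope classical_set_scope.
Local Open Scope ring_scope.

(** * Topologies as families of open sets, compared through convergent sequences *)

Section Topologies.
Variable T : Type.
Implicit Types tau sigma : set (set T).

Lemma open_of_nbhs tau (A : set T) : is_topology tau ->
  (forall x, A x -> nbhs_of_open tau x A) -> tau A.
Proof.
move=> [_ _ _ tU] nA.
suff -> : A = \bigcup_(B in [set B | tau B /\ B `<=` A]) B.
  by apply: tU => B [].
apply/seteqP; split=> [x /nA[B [tB Bx BA]]|x [B [_ BA] Bx]]; last exact: BA.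
by exists B.
Qed.

Lemma converges_in_sub tau sigma (u : nat -> T) x :
  sigma `<=` tau -> converges_in tau u x -> converges_in sigma u x.
Proof.
move=> st ux A [B [sB Bx BA]]; apply: ux.
by exists B; split => //; exact: st.
Qed.

(** If a [sigma]-open [A] were not a [tau]-neighbourhood of some [x] in [A], a sequence picked
    outside [A] in shrinking [tau]-neighbourhoods of [x] would converge to [x] in [tau] but not in
    [sigma]. *)
Lemma first_countable_sub tau sigma :
  is_topology tau -> is_first_countable tau ->
  (forall u x, converges_in tau u x -> converges_in sigma u x) ->
  sigma `<=` tau.
Proof.
move=> ttau fc cvg A sA; apply: open_of_nbhs => // x Ax.
have [B nB baseB] := fc x.
apply: contrapT => nA.
(* The local base need not be decreasing, so its finite intersections are used. *)
have nBs n : nbhs_of_open tau x [set y | forall i, (i < n)%N -> B i y].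
  elim: n => [|n [C [tC Cx CB]]].
    by exists setT; split => //; case: ttau.
  have [D [tD Dx DB]] := nB n.
  exists (C `&` D); split => //; first by case: ttau => _ _ + _; apply.
  move=> y [Cy Dy] i; rewrite ltnS leq_eqVlt => /predU1P[->|]; first exact: DB.
  exact: CB.
have ex n : exists y, (forall i, (i < n)%N -> B i y) /\ ~ A y.
  apply: contrapT => /forallNP no; apply: nA.
  have [C [tC Cx CB]] := nBs n; exists C; split => // y /CB By.
  by apply: contrapT => nAy; apply: (no y).
have [u uP] := choice ex.
have ux : converges_in tau u x.
  move=> C /baseB[n BC]; exists n.+1 => // m /= nm.
  by apply: BC; apply: (uP m).1.
have nbA : nbhs_of_open sigma x A by exists A; split.
have [N _ /(_ N (leqnn N))] := cvg u x ux A nbA.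
exact: (uP N).2.
Qed.

End Topologies.

(** * Nonnegative extended reals: convergence to zero and positive lower bounds *)

Lemma cvge0_nneg (R : realType) (f : nat -> \bar R) :
  (forall n, (0 <= f n)%E) ->
  (f k @[k --> \oo] --> 0%E) <->
  (forall e : R, 0 < e -> \forall k \near \oo, (f k < e%:E)%E).
Proof.
move=> f0; split=> [f_0 e e0|H].
  apply: (f_0 [set y | (y < e%:E)%E]).
  by apply: open_nbhs_nbhs; split; [exact: open_ereal_lt_ereal|rewrite /= lte_fin].
apply/fine_cvgP; split.
  near=> k; rewrite ge0_fin_numE//.
  rewrite (@lt_trans _ _ 1%:E) ?ltry//; near: k; exact: H.
apply/cvgrPdist_lt => e e0; near=> k.
have : (f k < e%:E)%E by near: k; exact: H.
rewrite /= sub0r normrN; case: (f k) (f0 k) => [r| |] //=.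
by rewrite lee_fin lte_fin => r0; rewrite ger0_norm.
Unshelve. all: end_near. Qed.

Lemma ereal_gt0_real (R : realType) (x : \bar R) : (0 < x)%E ->
  exists2 c : R, 0 < c & (c%:E <= x)%E.
Proof.
by case: x => [r r0||] //; [exists r|exists 1; rewrite ?leey].
Qed.

(** Serves to choose a radius that keeps a modular ball away from finitely many terms of a
    sequence. *)
Lemma ereal_gt0_min (R : realType) (f : nat -> \bar R) (N : nat) :
  exists2 c : R, 0 < c & forall n, (n < N)%N -> (0 < f n)%E -> (c%:E <= f n)%E.
Proof.
elim: N => [|N [c c0 cP]]; first by exists 1.
have [b b0 bP] : exists2 b : R, 0 < b & (0 < f N)%E -> (b%:E <= f N)%E.
  have [/ereal_gt0_real[b b0 bf]|] := boolP (0 < f N)%E; first by exists b.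
  by exists 1.
exists (Num.min b c); first by rewrite lt_min b0.
move=> n; rewrite ltnS leq_eqVlt => /predU1P[->|nN] fn0.
  by apply: le_trans (bP fn0); rewrite lee_fin ge_min lexx.
by apply: le_trans (cP n nN fn0); rewrite lee_fin ge_min lexx orbT.
Qed.

(** * Convexity estimates for a modular and its gauge *)

Section Modulars.
Variables (R : realType) (X : lmodType R) (rho : X -> \bar R).
Hypothesis rho_modular : is_convex_modular rho.
Implicit Types (l e r s t a : R) (u v : X).
Local Notation Xrho := (set_type (modular_space rho)).

Let rho_ge0 v : (0 <= rho v)%E. Proof. exact: modular_ge0. Qed.

Lemma modular0 : rho 0 = 0%E.
Proof. by apply/(modular_eq0 rho_modular). Qed.

Lemma modularN v : rho (- v) = rho v.
Proof.
by rewrite -scaleN1r; apply: (modular_unit rho_modular); rewrite normrN1.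
Qed.

Lemma modular_scale a v : 0 <= a <= 1 -> (rho (a *: v) <= a%:E * rho v)%E.
Proof.
move=> /(modular_convex rho_modular v 0).
by rewrite scaler0 addr0 modular0 mule0 adde0.
Qed.

Lemma modular_mono l1 l2 v : 0 <= l1 <= l2 -> (rho (l1 *: v) <= rho (l2 *: v))%E.
Proof.
move=> /andP[l10 l12].
have [l20|] := ltP 0 l2; last first.
  by move=> l20; have -> : l1 = l2 by apply/eqP; rewrite eq_le l12 (le_trans l20).
have a01 : 0 <= l1 / l2 <= 1.
  apply/andP; split; first by rewrite divr_ge0// ltW.
  by rewrite ler_pdivrMr// mul1r.
have -> : l1 *: v = (l1 / l2) *: (l2 *: v).
  by rewrite scalerA divfK// gt_eqF.
apply: le_trans (modular_scale _ _ a01) _.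
rewrite -[leRHS]mul1e; apply: lee_wpmul2r => //.
by rewrite lee_fin; case/andP: a01.
Qed.

Lemma modular_half u v :
  (rho (2^-1 *: (u + v)) <= 2^-1%:E * (rho u + rho v))%E.
Proof.
have h : 0 <= (2^-1 : R) <= 1 by lra.
have := modular_convex rho_modular u v h.
have -> : 1 - 2^-1 = 2^-1 :> R by lra.
by rewrite -scalerDr muleDr// ge0_adde_def // inE.
Qed.

Lemma modular_gauge_scale l t v : 0 < l -> 0 < t -> l * t <= 1 ->
  (rho (t^-1 *: v) <= 1)%E -> (rho (l *: v) <= (l * t)%:E)%E.
Proof.
move=> l0 t0 lt1 h.
have -> : l *: v = (l * t) *: (t^-1 *: v).
  by rewrite scalerA mulfK// gt_eqF.
have lt0 : 0 <= l * t by rewrite mulr_ge0// ltW.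
apply: le_trans (modular_scale _ _ _) _; first by rewrite lt0.
by rewrite -[leRHS]mule1; apply: lee_wpmul2l.
Qed.

(** The triangle inequality of the gauge: [(u + v) / (s + t)] is the convex combination of [u / s]
    and [v / t] with weights [s / (s + t)] and [t / (s + t)]. *)
Lemma modular_gauge_add s t u v : 0 < s -> 0 < t ->
  (rho (s^-1 *: u) <= 1)%E -> (rho (t^-1 *: v) <= 1)%E ->
  (rho ((s + t)^-1 *: (u + v)) <= 1)%E.
Proof.
move=> s0 t0 hu hv.
have st0 : 0 < s + t by rewrite addr_gt0.
pose a := s / (s + t).
have a01 : 0 <= a <= 1.
  apply/andP; split; first by rewrite divr_ge0 ?ltW.
  by rewrite ler_pdivrMr// mul1r lerDl ltW.
have b0 : 0 <= 1 - a by case/andP: a01; lra.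
have aE : 1 - a = t / (s + t) by rewrite /a; field; rewrite gt_eqF.
have -> : (s + t)^-1 *: (u + v) = a *: (s^-1 *: u) + (1 - a) *: (t^-1 *: v).
  rewrite !scalerA aE scalerDr /a; congr (_ *: _ + _ *: _).
    by rewrite mulrAC mulfV ?mul1r// gt_eqF.
  by rewrite mulrAC mulfV ?mul1r// gt_eqF.
apply: le_trans (modular_convex rho_modular _ _ a01) _.
have -> : 1%E = (a%:E * 1 + (1 - a)%:E * 1)%E :> \bar R.
  by rewrite !mule1 -EFinD subrKC.
by apply: leeD; apply: lee_wpmul2l => //; rewrite lee_fin; case/andP: a01.
Qed.

(** A finite bound [c >= 1] for [rho (l *: v)] is brought down to 1 by convexity towards 0, whence
    [t = c / l]. *)
Lemma modular_space_gauge v : modular_space rho v ->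
  exists2 t, 0 < t & (rho (t^-1 *: v) <= 1)%E.
Proof.
move=> [l l0 fin].
have [c c1 hc] : exists2 c, 1 <= c & (rho (l *: v) <= c%:E)%E.
  move: fin; case: (rho _) => [c _| |] //; last by exists 1; rewrite ?leNye.
  by exists (Num.max 1 c); rewrite ?le_max ?lexx// lee_fin le_max lexx orbT.
have c0 : 0 < c by lra.
exists (c / l); first by rewrite divr_gt0.
rewrite invf_div mulrC -scalerA.
apply: le_trans (modular_scale _ _ _) _.
  by rewrite invr_ge0 ltW//= invf_le1.
have -> : 1%E = (c^-1%:E * c%:E)%E :> \bar R by rewrite -EFinM mulVf// gt_eqF.
by apply: lee_wpmul2l => //; rewrite lee_fin invr_ge0 ltW.
Qed.

Lemma modular_space_of_gauge v t : 0 < t ->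
  (rho (t^-1 *: v) <= 1)%E -> modular_space rho v.
Proof.
move=> t0 h; exists t^-1; first by rewrite invr_gt0.
by rewrite (le_lt_trans h)// ltry.
Qed.

Lemma modular_space0 : modular_space rho 0.
Proof. by exists 1 => //; rewrite scaler0 modular0 ltry. Qed.

Lemma modular_spaceD u v :
  modular_space rho u -> modular_space rho v -> modular_space rho (u + v).
Proof.
move=> /modular_space_gauge[s s0 us] /modular_space_gauge[t t0 vt].
by apply: (@modular_space_of_gauge _ (s + t)); [lra|exact: modular_gauge_add].
Qed.

Lemma modular_spaceB (x y : Xrho) : modular_space rho (\val y - \val x).
Proof.
apply: modular_spaceD; first exact: set_valP.
have [l l0 xl] : modular_space rho (\val x) by exact: set_valP.
by exists l => //; rewrite scalerN modularN.
Qed.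

(** * Luxemburg balls against modular balls *)

Lemma luxemburg_ltP v r : modular_space rho v ->
  luxemburg rho v < r <->
  exists t, [/\ 0 < t, t < r & (rho (t^-1 *: v) <= 1)%E].
Proof.
move=> vM; split=> [|[t [t0 tr ht]]].
  move=> /inf_lt[|t [t0 ht] tr]; last by exists t.
  by have [t t0 ht] := modular_space_gauge _ vM; exists t.
apply: le_lt_trans tr; apply: ge_inf => //.
by exists 0 => s [/ltW].
Qed.

Definition luxemburg_ball r (x : Xrho) : set Xrho :=
  [set y | luxemburg rho (\val y - \val x) < r].

Lemma luxemburg_ballP r (x y : Xrho) : luxemburg_ball r x y <->
  exists t, [/\ 0 < t, t < r & (rho (t^-1 *: (\val y - \val x)) <= 1)%E].
Proof. exact/luxemburg_ltP/modular_spaceB. Qed.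

Lemma luxemburg_ball_center r x : 0 < r -> luxemburg_ball r x x.
Proof.
move=> r0; apply/luxemburg_ballP; exists (r / 2); split; [lra|lra|].
by rewrite subrr scaler0 modular0.
Qed.

Lemma luxemburg_ball_sub_modular_ball l e x : 0 < l -> 0 < e ->
  exists2 r, 0 < r & luxemburg_ball r x `<=` modular_ball rho l e x.
Proof.
(* The cap at 1 keeps [l * t <= 1], so that convexity towards 0 applies. *)
move=> l0 e0; pose c := Num.min e 1.
have c0 : 0 < c by rewrite lt_min e0 ltr01.
exists (c / l); first by rewrite divr_gt0.
move=> y /luxemburg_ballP[t [t0 tr ht]].
have ltc : l * t < c by rewrite mulrC -ltr_pdivlMr.
have [lte lt1] : l * t < e /\ l * t < 1.
  by move: ltc; rewrite /c lt_min => /andP[].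
rewrite /modular_ball /= /scaled.
by apply: le_lt_trans (modular_gauge_scale _ _ _ l0 t0 (ltW lt1) ht) _; rewrite lte_fin.
Qed.

(** The scale [2 / r] is the inverse of [r / 2], which is a gauge witness below [r]. *)
Lemma modular_ball_sub_luxemburg_ball r x : 0 < r ->
  modular_ball rho (2 / r) 1 x `<=` luxemburg_ball r x.
Proof.
move=> r0 y /ltW h; apply/luxemburg_ballP; exists (r / 2).
by rewrite invf_div; split => //; lra.
Qed.

Lemma tau_norm_star : tau_norm rho = tau_star rho.
Proof.
apply/seteqP; split=> A hA x /hA.
  move=> [r r0 rA]; exists (2 / r), 1; split => //; first by rewrite divr_gt0.
  by apply: subset_trans rA; exact: modular_ball_sub_luxemburg_ball.
move=> [l [e [l0 e0 leA]]].
have [r r0 rle] := luxemburg_ball_sub_modular_ball l e x l0 e0.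
by exists r => //; apply: subset_trans leA.
Qed.

(** A gauge witness [t < r] for [y] leaves room for the ball of radius [r - t] around [y]. *)
Lemma luxemburg_ball_open r x : tau_star rho (luxemburg_ball r x).
Proof.
rewrite -tau_norm_star => y /luxemburg_ballP[t [t0 tr ht]].
exists (r - t); first by lra.
move=> z /luxemburg_ballP[s [s0 sr hs]]; apply/luxemburg_ballP.
exists (s + t); split; [lra|lra|].
have -> : \val z - \val x = (\val z - \val y) + (\val y - \val x).
  by rewrite addrA subrK.
exact: modular_gauge_add.
Qed.

Lemma modular_ball_mono l1 l2 e1 e2 x : 0 <= l1 <= l2 -> e2 <= e1 ->
  modular_ball rho l2 e2 x `<=` modular_ball rho l1 e1 x.
Proof.
move=> l12 e12 y; rewrite /modular_ball /= /scaled => h.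
apply: (le_lt_trans (modular_mono _ _ _ l12)).
by apply: lt_le_trans h _; rewrite lee_fin.
Qed.

(** * Inclusions between the topologies and first countability *)

Lemma tau_scaled_sub_star l : 0 < l -> tau_scaled rho l `<=` tau_star rho.
Proof. by move=> l0 A hA x /hA[e e0 eA]; exists l, e. Qed.

Lemma tau_scaled_mono l1 l2 : 0 <= l1 <= l2 ->
  tau_scaled rho l1 `<=` tau_scaled rho l2.
Proof.
move=> l12 A hA x /hA[e e0 eA]; exists e => //.
by apply: subset_trans eA; exact: modular_ball_mono.
Qed.

Lemma tau_scaledI l A B :
  tau_scaled rho l A -> tau_scaled rho l B -> tau_scaled rho l (A `&` B).
Proof.
move=> hA hB x [/hA[d d0 dA] /hB[e e0 eB]].
exists (Num.min d e); first by rewrite lt_min d0.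
by move=> y yb; split; [apply: dA|apply: eB]; apply: lt_le_trans yb _;
  rewrite lee_fin ge_min lexx ?orbT.
Qed.

Lemma tau_star_topology : is_topology (tau_star rho).
Proof.
split=> [|x _|A B hA hB x [/hA[l1 [e1 [l10 e10 h1]]] /hB[l2 [e2 [l20 e20 h2]]]]|].
- by move=> x.
- by exists 1, 1; split.
- exists (Num.max l1 l2), (Num.min e1 e2); split.
  + by rewrite lt_max l10.
  + by rewrite lt_min e10.
  + move=> y yb; split; [apply: h1|apply: h2]; move: y yb;
    by apply: modular_ball_mono;
      rewrite ?ge_min ?le_max ?lexx ?orbT ?andbT// ltW.
- move=> F FT x [A FA Ax]; have [l [e [l0 e0 h]]] := FT _ FA _ Ax.
  by exists l, e; split => // y /h Ay; exists A.
Qed.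

Lemma tau_init_sub_star : tau_init rho `<=` tau_star rho.
Proof.
move=> A; apply; split; first exact: tau_star_topology.
by move=> B [l l0]; exact: tau_scaled_sub_star.
Qed.

Lemma tau_scaled_sub_init : finer_than_scaled (tau_init rho).
Proof. by have [[]] := tau_init_weakest rho. Qed.

Lemma luxemburg_ball_nbhs r x : 0 < r ->
  nbhs_of_open (tau_star rho) x (luxemburg_ball r x).
Proof.
move=> r0; exists (luxemburg_ball r x).
by split; [exact: luxemburg_ball_open|exact: luxemburg_ball_center|].
Qed.

Lemma nbhs_luxemburg_ball x A : nbhs_of_open (tau_star rho) x A ->
  exists2 r, 0 < r & luxemburg_ball r x `<=` A.
Proof.
rewrite -tau_norm_star => -[B [hB /hB[r r0 rB] BA]].
by exists r => // y /rB /BA.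
Qed.

Lemma tau_star_first_countable : is_first_countable (tau_star rho).
Proof.
move=> x; exists (fun n => luxemburg_ball n.+1%:R^-1 x) => [n|A].
  by apply: luxemburg_ball_nbhs; rewrite invr_gt0.
move=> /nbhs_luxemburg_ball[r r0 rA].
have [n nr] := ltr_add_invr r0; rewrite add0r in nr.
by exists n => y yn; apply: rA; apply: lt_trans nr.
Qed.

(** * Convergent sequences of [tau_star] and of the scaled topologies *)

Lemma tau_star_cvgP (u : nat -> Xrho) x :
  converges_in (tau_star rho) u x <->
  (forall l, 0 < l ->
    scaled rho l (\val (u k) - \val x) @[k --> \oo] --> 0%E).
Proof.
split=> [ux l l0|ux A [B [hB Bx BA]]].
  apply/cvge0_nneg => [n|e e0]; first exact: rho_ge0.
  have [r r0 rle] := luxemburg_ball_sub_modular_ball l e x l0 e0.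
  have : \forall k \near \oo, luxemburg_ball r x (u k).
    exact: ux (luxemburg_ball_nbhs r x r0).
  by apply: filterS => k /rle.
have [l [e [l0 e0 leB]]] := hB x Bx.
have /cvge0_nneg small := ux l l0.
have {}small := small (fun=> rho_ge0 _) e e0.
by apply: filterS small => k /leB /BA.
Qed.

(* The terms staying away from [x] would otherwise form, together with at most
   one [l]-limit [y <> x], a closed set that misses [x]. *)
Lemma tau_scaled_cvg l (u : nat -> Xrho) x : 0 < l ->
  converges_in (tau_scaled rho l) u x ->
  scaled rho l (\val (u k) - \val x) @[k --> \oo] --> 0%E.
Proof.
move=> l0 ux; apply/cvge0_nneg => [n|e e0]; first exact: rho_ge0.
pose d (y z : Xrho) : \bar R := scaled rho l (\val y - \val z).
have d0 y z : d y z = 0%E -> y = z.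
  move=> /(modular_eq0 rho_modular)/eqP; rewrite scaler_eq0 gt_eqF//= subr_eq0.
  by move=> /eqP/val_inj.
have dC y z : d y z = d z y.
  by rewrite /d /scaled -(modularN (_ *: _)) -scalerN opprB.
have d_gt0 y z : y <> z -> (0 < d y z)%E.
  by move=> yz; rewrite lt_def rho_ge0 andbT; apply/eqP => /d0.
(* This replaces the triangle inequality, at the cost of halving the scale. *)
have d_half y z w :
    (scaled rho (l / 2) (\val y - \val z) <= 2^-1%:E * (d w y + d w z))%E.
  rewrite (dC w y); have -> : \val y - \val z = (\val y - \val w) + (\val w - \val z).
    by rewrite addrA subrK.
  by rewrite /scaled mulrC -scalerA scalerDr; exact: modular_half.
(* By [d_half], terms that approach [y] cannot also approach [z <> y]: those from [N] on keep
   [d]-distance [c] from [z], while [a] handles the earlier ones and [b] handles [y]. *)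
have far_open (k : nat -> nat) y : (forall n, (d (u (k n)) y < n.+1%:R^-1%:E)%E) ->
    (forall n, u (k n) <> y) ->
    tau_scaled rho l [set z | z <> y /\ forall n, z <> u (k n)].
  move=> uy uNy z [zy zu].
  have [c c0 cz] : exists2 c, 0 < c &
      (c%:E <= scaled rho (l / 2) (\val y - \val z))%E.
    apply: ereal_gt0_real; rewrite lt_def rho_ge0 andbT.
    apply/eqP => /(modular_eq0 rho_modular)/eqP.
    rewrite scaler_eq0 gt_eqF ?divr_gt0//= subr_eq0 => /eqP/val_inj.
    by move/esym.
  have [N cN] := ltr_add_invr c0; rewrite add0r in cN.
  have [a a0 aP] := ereal_gt0_min R (fun n => d (u (k n)) z) N.
  have [b b0 bP] := ereal_gt0_real _ _ (d_gt0 _ _ (not_eq_sym zy)).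
  exists (Num.min c (Num.min a b)); first by rewrite !lt_min c0 a0.
  move=> w; rewrite /modular_ball /= -/(d w z) => dwz; split=> [wy|n wn].
    move: dwz; rewrite wy ltNge => /negP; apply; apply: le_trans bP.
    by rewrite lee_fin !ge_min lexx !orbT.
  move: dwz; rewrite wn ltNge => /negP; apply.
  have [nN|Nn] := ltnP n N.
    apply: le_trans (aP n nN (d_gt0 _ _ (not_eq_sym (zu n)))).
    by rewrite lee_fin !ge_min lexx !orbT.
  apply: (@le_trans _ _ c%:E); first by rewrite lee_fin ge_min lexx.
  rewrite leNgt; apply/negP => dc.
  have dy : (d (u (k n)) y < c%:E)%E.
    apply: (lt_trans (uy n)); rewrite lte_fin; apply: le_lt_trans cN.
    by rewrite lef_pV2 ?posrE// ler_nat.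
  have := le_trans cz (d_half y z (u (k n))); rewrite leNgt => /negP; apply.
  have -> : c%:E = (2^-1%:E * (c%:E + c%:E))%E by rewrite -EFinD -EFinM; congr EFin; lra.
  by rewrite lte_pmul2l// ?lte_fin ?invr_gt0//; exact: lteD.
apply: contrapT => ncvg.
pose bad k := (e%:E <= d (u k) x)%E.
have badN N : exists2 k, (N <= k)%N & bad k.
  apply: contrapT => h; apply: ncvg; exists N => // k /= Nk.
  by rewrite ltNge; apply/negP => ek; apply: h; exists k.
have meets A : tau_scaled rho l A -> A x -> exists N, forall k, (N <= k)%N -> A (u k).
  by move=> hA Ax; have [N _ NA] := ux A (ex_intro _ A (And3 hA Ax (@subset_refl _ A)));
    exists N.
have dxx : d x x = 0%E by rewrite /d /scaled subrr scaler0 modular0.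
pose U := [set z | forall k, bad k -> z <> u k].
have Ux : U x by move=> k + xk; rewrite /bad -xk dxx lee_fin leNgt e0.
(* If [U] is open, [u] eventually avoids its own bad terms, which is absurd. Otherwise some [y] in
   [U] has bad terms in each of its balls. *)
have [/meets/(_ Ux)[N NU]|] := pselect (tau_scaled rho l U).
  by have [k /NU Uk /Uk] := badN N.
move=> /existsNP[y /not_implyP[Uy yball]].
have /choice[k kP] n : exists k, bad k /\ (d (u k) y < n.+1%:R^-1%:E)%E.
  apply: contrapT => h; apply: yball; exists n.+1%:R^-1; first by rewrite invr_gt0.
  by move=> w wy j badj wj; apply: h; exists j; rewrite -wj.
have uNy n : u (k n) <> y by move=> /esym; apply: Uy; exact: (kP n).1.
have [|N NV] := meets _ (far_open k y (fun n => (kP n).2) uNy).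
  split=> [xy|n]; last by apply: Ux; exact: (kP n).1.
  have [n ne] := ltr_add_invr e0; rewrite add0r in ne.
  have [+ ] := kP n; rewrite /bad xy leNgt => /negP + dn; apply.
  by apply: lt_trans dn _; rewrite lte_fin.
(* The indices [k n] need not increase, but the terms before [N] other than [y] stay at distance at
   least [a] from [y], so a large [n] forces [k n >= N]. *)
have [a a0 aP] := ereal_gt0_min R (fun n => d (u n) y) N.
have [n na] := ltr_add_invr a0; rewrite add0r in na.
have [kN|Nk] := ltnP (k n) N; last by have [_ /(_ n)] := NV _ Nk.
have := aP _ kN (d_gt0 _ _ (uNy n)); rewrite leNgt => /negP; apply.
by apply: lt_trans (kP n).2 _; rewrite lte_fin.
Qed.



(* The [tau_scaled rho l] increase with [l], so their union is stable under
   binary intersections. *)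
Lemma tau_init_nbhs A (x : Xrho) : tau_init rho A -> A x ->
  (* The sets that are, at each of their points, a neighbourhood for some scaled topology form a
     topology finer than all of these, hence one containing [tau_init]. *)
  exists2 l, 0 < l & nbhs_of_open (tau_scaled rho l) x A.
Proof.
move=> hA; move: x; apply: (hA [set A | forall x, A x ->
  exists2 l, 0 < l & nbhs_of_open (tau_scaled rho l) x A]).
split; last first.
  by move=> B [l l0 hB] x Bx; exists l => //; exists B; split.
split=> [x //|x _|B C hB hC x [/hB[k k0 [V [hV Vx VB]]] /hC[l l0 [W [hW Wx WC]]]]|].
- by exists 1 => //; exists setT; split => // y _; exists (1 : R).
- exists (Num.max k l); first by rewrite lt_max k0.
  exists (V `&` W); split => // [|y [/VB ? /WC ?]//].
  apply: (tau_scaledI); [move: V hV {Vx VB}|move: W hW {Wx WC}];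
    by apply: tau_scaled_mono => //; rewrite le_max lexx ?orbT ltW.
- move=> F hF x [B FB Bx]; have [l l0 [V [hV Vx VB]]] := hF _ FB x Bx.
  by exists l => //; exists V; split => // y /VB By; exists B.
Qed.

End Modulars.

(** * A modular for which [tau_init] and [tau_star] differ *)

Section Counterexample.
Variable R : realType.
Implicit Types (x u v : nat -> R) (l a t s : R).

Definition cell (n : nat) t : \bar R :=
  if `|t| <= 1 then (`|t| / n.+1%:R)%:E else +oo%E.

(* The gauge of [{rho <= 1}] is the sup norm, but on its unit ball [rho] is a
   weighted sup norm, for which the tails of a constant sequence tend to 0. *)
Definition two_norm_modular x : \bar R := ereal_sup (range (fun n => cell n (x n))).
Local Notation rho := two_norm_modular.

Lemma cell_ge0 n t : (0 <= cell n t)%E.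
Proof. by rewrite /cell; case: ifP => // _; rewrite lee_fin divr_ge0. Qed.

Lemma cell_le x n : (cell n (x n) <= rho x)%E.
Proof. by apply: ereal_sup_ubound; exists n. Qed.

Lemma two_norm_le x (c : \bar R) : (forall n, (cell n (x n) <= c)%E) -> (rho x <= c)%E.
Proof. by move=> h; apply: ge_ereal_sup => _ [n _ <-]. Qed.

Lemma two_norm_pinfty x n : 1 < `|x n| -> rho x = +oo%E.
Proof.
move=> xn; apply/eqP; rewrite -leye_eq; apply: le_trans (cell_le x n).
by rewrite /cell ifN// -ltNge.
Qed.

Lemma cell_convex n a t s : 0 <= a <= 1 ->
  (cell n (a * t + (1 - a) * s) <= a%:E * cell n t + (1 - a)%:E * cell n s)%E.
Proof.
move=> /andP[a0 a1].
(* The endpoints are treated apart because [0 * +oo = 0]; for [0 < a < 1] an infinite cell makes the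
   right-hand side infinite. *)
have [->|an0] := eqVneq a 0.
  by rewrite subr0 mul0r mul1r add0r mul0e mul1e add0e.
have [->|an1] := eqVneq a 1.
  by rewrite subrr mul0r mul1r addr0 mul0e mul1e adde0.
have a_gt0 : 0 < a by rewrite lt_def an0.
have a_lt1 : 0 < 1 - a by rewrite subr_gt0 lt_def eq_sym an1.
rewrite [cell n t]/cell; case: ifPn => t1; last first.
  rewrite gt0_muley ?lte_fin// addye ?leey// gt_eqF// (lt_le_trans ltNy0)//.
  by rewrite mule_ge0 ?cell_ge0// lee_fin ltW.
rewrite [cell n s]/cell; case: ifPn => s1; last first.
  by rewrite gt0_muley ?lte_fin// addey ?leey.
have ts : `|a * t + (1 - a) * s| <= a * `|t| + (1 - a) * `|s|.
  apply: le_trans (ler_normD _ _) _.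
  by rewrite !normrM (gtr0_norm a_gt0) (gtr0_norm a_lt1).
rewrite /cell ifT; last by nra.
rewrite -!EFinM -EFinD lee_fin !mulrA -mulrDl.
by rewrite ler_pM2r// invr_gt0.
Qed.

Lemma two_norm_is_modular : is_convex_modular rho.
Proof.
split.
- by move=> u; exact: le_trans (cell_ge0 0%N (u 0%N)) (cell_le u 0%N).
- move=> u; split=> [u0|->]; last first.
    apply/eqP; rewrite eq_le (le_trans (cell_ge0 0%N 0) (cell_le 0 0%N)) andbT.
    by apply: two_norm_le => n; rewrite /cell normr0 ler01 mul0r.
  apply/funext => n; apply/eqP; rewrite -normr_eq0.
  have := cell_le u n; rewrite u0 /cell; case: ifP => // _.
  by rewrite lee_fin pmulr_lle0 ?invr_gt0// normr_le0 normr_eq0.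
- move=> a u a1.
  suff E : (fun n => cell n ((a *: u) n)) = (fun n => cell n (u n)).
    by rewrite /two_norm_modular E.
  by apply/funext => n; rewrite /cell /= normrM a1 mul1r.
- move=> a u v a01; apply: two_norm_le => n.
  apply: le_trans (cell_convex _ _ _ _ a01) _.
  by case/andP: a01 => a0 a1; apply: leeD; apply: lee_wpmul2l;
    rewrite ?lee_fin ?subr_ge0// cell_le.
Qed.

(** If a coordinate of [l0 *: u] exceeds 1 in modulus, it still does for [l] close to [l0], and both
    values are [+oo]. Otherwise [rho] is finite at [l0 *: u], and homogeneity of the finite cells
    squeezes [rho (l *: u)] between [l / l0 * c] and [c]. *)
Lemma two_norm_left_continuous : left_continuous rho.
Proof.
move=> u l0 l0_gt0.
have [[n un]|/forallNP u1] := pselect (exists n, 1 < `|l0 * u n|).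
  have un0 : 0 < `|u n| by rewrite normr_gt0; apply: contraTneq un => ->;
    rewrite mulr0 normr0 ltr10.
  rewrite (two_norm_pinfty (l0 *: u) n un).
  apply: cvg_near_cst; near=> l.
  have l_gt : `|u n|^-1 < l.
    near: l; apply: nbhs_left_gt.
    by rewrite -div1r ltr_pdivrMr// -(gtr0_norm l0_gt0) -normrM.
  have l_gt0 : 0 < l by apply: lt_trans l_gt; rewrite invr_gt0.
  apply: (two_norm_pinfty (l *: u) n).
  have -> : (l *: u) n = l * u n by [].
  by rewrite normrM (gtr0_norm l_gt0) -ltr_pdivrMr// div1r.
have {}u1 n : `|l0 * u n| <= 1 by rewrite leNgt; apply/negP; exact: u1.
have rho1 : (rho (l0 *: u) <= 1)%E.
  apply: two_norm_le => n; rewrite /cell /= u1 lee_fin.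
  rewrite ler_pdivrMr// mul1r (le_trans (u1 n))// ler1n//.
have [c cE] : exists c, rho (l0 *: u) = c%:E.
  exists (fine (rho (l0 *: u))); rewrite fineK// ge0_fin_numE.
    by rewrite (le_lt_trans rho1)// ltry.
  exact: modular_ge0 two_norm_is_modular _.
rewrite cE.
apply: (@squeeze_cvge _ _ _ _ (fun l => (l / l0 * c)%:E) _ (cst c%:E)).
- near=> l.
  have l_gt0 : 0 < l by near: l; exact: nbhs_left_gt.
  have ll0 : l <= l0 by near: l; exact: nbhs_left_le.
  rewrite -cE; apply/andP; split; last first.
    by apply: (modular_mono _ _ _ two_norm_is_modular); rewrite ltW.
  have -> : (l / l0 * c)%:E = ((l / l0)%:E * rho (l0 *: u))%E by rewrite cE.
  rewrite muleC -lee_pdivlMr ?divr_gt0//.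
  apply: two_norm_le => n; rewrite lee_pdivlMr ?divr_gt0//.
  apply: le_trans (cell_le (l *: u) n).
  have lu1 : `|l * u n| <= 1.
    apply: le_trans (u1 n); rewrite !normrM ler_wpM2r// !gtr0_norm//.
  rewrite /cell /= u1 lu1 -EFinM lee_fin !normrM (gtr0_norm l_gt0) (gtr0_norm l0_gt0).
  set d := _.+1%:R^-1; have -> // : l0 * `|u n| * d * (l / l0) = l * `|u n| * d.
  by field; rewrite gt_eqF.
- apply: cvg_EFin; first by near=> l.
  have : l / l0 * c @[l --> l0^'-] --> l0 / l0 * c.
    apply: cvg_at_left_filter.
    by apply: cvgM; [apply: cvgM; [exact: cvg_id|exact: cvg_cst]|exact: cvg_cst].
  by rewrite divff ?mul1r// gt_eqF.
- exact: cvg_cst.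
Unshelve. all: end_near. Qed.

Definition tail m a : nat -> R := fun n => if (m <= n)%N then a else 0.

(** The scaled tail has entries 0 and 1, so every cell is finite, and the weights from [m] on are at
    most [m.+1%:R^-1]. *)
Lemma two_norm_tail_le l m : 0 < l ->
  (rho (l *: tail m l^-1) <= (m.+1%:R^-1)%:E)%E.
Proof.
move=> l0; apply: two_norm_le => n.
have -> : (l *: tail m l^-1) n = l * tail m l^-1 n by [].
rewrite /cell /tail; case: leqP => mn; last by rewrite mulr0 normr0 ler01 mul0r lee_fin.
rewrite mulfV ?gt_eqF// normr1 lexx lee_fin mul1r.
by rewrite lef_pV2 ?posrE// ler_nat.
Qed.

Local Notation Xrho := (set_type (modular_space rho)).

(** The uniform bound [c < 1] makes this the open unit ball of the sup norm; [|x n| < 1] for all [n]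
    would be a larger set. *)
Definition open_sup_ball : set Xrho :=
  [set x | exists2 c, c < 1 & forall n, `|\val x n| <= c].

Lemma open_sup_ball_star : tau_star rho open_sup_ball.
Proof.
(* At scale [2 / (1 - c)] a finite cell forces [|y n - x n| <= (1 - c) / 2], so [y] is bounded by
   [(1 + c) / 2 < 1]. *)
move=> x [c c1 xc]; exists (2 / (1 - c)), 1; split => //.
  by rewrite divr_gt0// subr_gt0.
move=> y yx; exists ((1 + c) / 2); first by lra.
move=> n; have := le_lt_trans (cell_le _ n) yx.
rewrite /cell; case: ifPn => // yxn _.
have k0 : 0 <= 2 / (1 - c) by rewrite divr_ge0// subr_ge0 ltW.
move: yxn; rewrite normrM (ger0_norm k0) => yxn.
have {}yxn : `|\val y n - \val x n| <= (1 - c) / 2.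
  by move: yxn; rewrite mulrAC ler_pdivrMr ?subr_gt0// mul1r => h; lra.
have := ler_normD (\val y n - \val x n) (\val x n); rewrite subrK.
by have := xc n; lra.
Qed.

(* The radius [e] may shrink at each step, but the tail of height [l^-1] that is
   added can be pushed far enough to fit. *)
Lemma tau_scaled_unbounded l (U : set Xrho) (x0 : Xrho) (k : nat) : 0 < l ->
  tau_scaled rho l U -> U x0 -> \val x0 = 0 ->
  exists2 x, U x & exists m, forall n, (m <= n)%N -> \val x n = k%:R / l.
Proof.
move=> l0 hU Ux0 x00; elim: k => [|k [x Ux [m xm]]].
  by exists x0 => //; exists 0%N => n _; rewrite x00 mul0r.
have [e e0 eU] := hU x Ux.
have [N Ne] := ltr_add_invr e0; rewrite add0r in Ne.
(* Beyond [m] the sequence [x] is constant; beyond [N] the added tail fits into the ball of radius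
   [e]. *)
pose M := maxn m N.
pose v := tail M l^-1.
have vM : (rho (l *: v) <= (M.+1%:R^-1)%:E)%E by exact: two_norm_tail_le.
have yM : modular_space rho (\val x + v).
  apply: (modular_spaceD _ _ _ two_norm_is_modular); first exact: set_valP.
  by exists l => //; apply: le_lt_trans vM (ltry _).
exists (SigSub (mem_set yM)).
  apply: eU; rewrite /modular_ball /= /scaled addrAC subrr add0r.
  apply: le_lt_trans vM _; rewrite lte_fin; apply: le_lt_trans Ne.
  by rewrite lef_pV2 ?posrE// ler_nat ltnS leq_maxr.
exists M => n Mn.
rewrite -[LHS]/(\val x n + v n).
rewrite /v /tail Mn xm; last by apply: leq_trans Mn; exact: leq_maxl.
by rewrite mulrSr mulrDl mul1r.
Qed.

(** Otherwise some [tau_scaled rho l]-open set around 0 would lie in the ball, yet it contains a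
    sequence with an entry [k / l] where [k > l]. *)
Lemma open_sup_ball_not_init : ~ tau_init rho open_sup_ball.
Proof.
pose x0 : Xrho := SigSub (mem_set (modular_space0 _ _ _ two_norm_is_modular)).
have x00 : \val x0 = 0 by [].
have Bx0 : open_sup_ball x0.
  by exists 0 => // n; rewrite x00 normr0.
move=> /(tau_init_nbhs _ _ _ two_norm_is_modular)/(_ Bx0).
move=> [l l0 [U [hU Ux0 UB]]].
have lk := archi_boundP (ltW l0).
have [x /UB[c c1 xc] [m /(_ m (leqnn m)) xm]] :=
  tau_scaled_unbounded _ _ _ (Num.bound l) l0 hU Ux0 x00.
have := le_lt_trans (xc m) c1.
by rewrite xm ger0_norm ?divr_ge0 ?(ltW l0)// ltr_pdivrMr// mul1r ltNge (ltW lk).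
Qed.

End Counterexample.

Theorem theorem4p1 (R : realType) :
  (forall (X : lmodType R) (rho : X -> \bar R),
    is_convex_modular rho -> left_continuous rho ->
    (* (i) *)
    [/\ is_topology (tau_star rho),
        forall l : R, 0 < l -> tau_scaled rho l `<=` tau_star rho
      & tau_init rho `<=` tau_star rho] /\
    (* (ii) *)
    ((forall (u : nat -> set_type (modular_space rho))
             (x : set_type (modular_space rho)),
        converges_in (tau_star rho) u x <->
        (forall l : R, 0 < l ->
           scaled rho l (\val (u k) - \val x) @[k --> \oo] --> 0%E)) /\
     (forall (u : nat -> set_type (modular_space rho))
             (x : set_type (modular_space rho)),
        converges_in (tau_init rho) u x <-> converges_in (tau_star rho) u x)) /\
    (* (iii) *)
    (tau_norm rho = tau_star rho /\
     is_weakest [set tau | [/\ is_topology tau, is_first_countable tau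
                             & finer_than_scaled tau]] (tau_norm rho))) /\
  (* the parenthetical remark in (ii) *)
  (exists (X : lmodType R) (rho : X -> \bar R),
    [/\ is_convex_modular rho, left_continuous rho
      & tau_init rho <> tau_star rho]).
Proof.
split=> [X rho hrho _|]; last first.
  (* The carrier is the space of all real sequences; the modular space in it is that of the bounded
     ones. *)
  exists (nat -> R), (@two_norm_modular R); split.
  - exact: two_norm_is_modular.
  - exact: two_norm_left_continuous.
  - move=> E; apply: (open_sup_ball_not_init R).
    by rewrite E; exact: open_sup_ball_star.
have tstar := tau_star_topology _ _ _ hrho.
(* Used twice: for [tau_init], and for the minimality among first-countable topologies. *)
have cvg_finer tau : finer_than_scaled tau -> forall u x,
    converges_in tau u x -> converges_in (tau_star rho) u x.
  move=> ftau u x ux; apply/tau_star_cvgP => // l l0.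
  by apply: tau_scaled_cvg => //; apply: converges_in_sub ux; exact: ftau.
split; [|split; split].
- split => //; [exact: tau_scaled_sub_star|exact: tau_init_sub_star].
- by move=> u x; exact: tau_star_cvgP.
- move=> u x; split; first by apply: cvg_finer; exact: tau_scaled_sub_init.
  by apply: converges_in_sub; exact: tau_init_sub_star.
- exact: tau_norm_star.
- rewrite tau_norm_star//; split.
    split => //; first exact: tau_star_first_countable.
    by move=> l l0; exact: tau_scaled_sub_star.
  move=> tau [ttau fctau ftau]; apply: first_countable_sub => //.
  exact: cvg_finer.
Qed.
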